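(* Let $G\le\mathrm{Aut}(T)$ be a closed mixing group. Then $\mathrm{FPP}(G)=0$.
   Context: $T$ is the $d$-regular rooted tree ($d\ge2$) whose vertices are finite words over $X=\{1,\dots,d\}$, root the empty word $\emptyset$, and $v$ adjacent to $vx$ for $x\in X$; $|v|$ is word length and level $n$ is $\mathcal L_n=\{v:|v|=n\}$. $\mathrm{Aut}(T)$ acts on $T$ and carries the profinite (congruence) topology. For $g\in\mathrm{Aut}(T)$ and $v\in T$, the section $g|_v\in\mathrm{Aut}(T)$ is the unique element with $(vw)^g=v^g w^{g|_v}$ for all $w$. $\pi_m:\mathrm{Aut}(T)\to\mathrm{Aut}(T^m)$ is restriction to the truncated tree of the first $m$ levels; $g|_v^m:=\pi_m(g|_v)$. For $H\le\mathrm{Aut}(T)$: $\mathrm{st}_H(v)$ is the stabilizer of $v$, $\mathrm{St}_H(n)=\bigcap_{v\in\mathcal L_n}\mathrm{st}_H(v)$, and $H_v^m:=\{h|_v^m:h\in\mathrm{st}_H(v)\}$, $H_v:=\{h|_v:h\in\mathrm{st}_H(v)\}$. $G$ is self-similar if $g|_v\in G$ for all $g\in G,v\in T$; level-transitive if it acts transitively on each $\mathcal L_n$; fractal if self-similar, level-transitive and $G_v=G$ for all $v$. A fractal $G$ is mixing if (i) for every $n\ge1$ and $u\in\mathcal L_n$ and $k\ge1$, $\mathrm{St}_G(n)$ acts transitively on $\{uw:|w|=k\}$; and (ii) for all $n,m\ge1$ there is $N=N(m)\ge0$ such that $\mathrm{St}_G(n)_v^m=\pi_m(G)$ for every $v$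 with $|v|\ge n+N$. $\mathrm{FPP}(G):=\mu_G(\{g\in G: g\text{ fixes an end of }T\})$, where $\mu_G$ is the normalized Haar measure and an end is an infinite rooted path. *)

(* Defs.v *)
From HB Require Import structures.
From mathcomp Require Import all_boot all_order all_algebra.
From mathcomp Require Import all_classical all_reals all_analysis.

Set Implicit Arguments.
Unset Strict Implicit.
Unset Printing Implicit Defensive.

Local Open Scope classical_set_scope.

(** * The rooted tree and its automorphism group *)

(* The alphabet X = {1, ..., d} is encoded as 'I_d = {0, ..., d - 1}. *)
Notation vertex d := (seq 'I_d).

Section Tree.
Variable d : nat.
Implicit Types (u v w : vertex d) (n m k : nat).

Definition child u v := exists x : 'I_d, v = rcons u x.

Definition adjacent u v := child u v \/ child v u.

Definition level n : set (vertex d) := [set v | size v = n].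

Definition is_tree_aut (f : vertex d -> vertex d) :=
  [/\ bijective f, f [::] = [::] &
      forall u v, adjacent u v <-> adjacent (f u) (f v)].

Record treeAut := TreeAut {
  aut_fun :> vertex d -> vertex d;
  autP : is_tree_aut aut_fun }.

HB.instance Definition _ := gen_eqMixin treeAut.
HB.instance Definition _ := gen_choiceMixin treeAut.

Implicit Types g h : treeAut.

Lemma treeAut_eq g h : g =1 h -> g = h.
Proof.
case: g h => [f fP] [f' f'P] /= /funext ff'.
by subst f'; congr TreeAut; exact: Prop_irrelevance.
Qed.

Lemma aut_inj g : injective g.
Proof. by case: (autP g) => /bij_inj. Qed.

Lemma aut_root g : g [::] = [::].
Proof. by case: (autP g). Qed.

Lemma aut_child g u v : child u v -> child (g u) (g v).
Proof.
elim/last_ind: u v => [|u y IH] v uv.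
  have [_ _ gadj] := autP g.
  have : adjacent (g [::]) (g v) by apply: (gadj _ _).1; left.
  rewrite aut_root; case=> // -[x e].
  by have := congr1 size e; rewrite size_rcons.
have [_ _ gadj] := autP g.
have : adjacent (g (rcons u y)) (g v) by apply: (gadj _ _).1; left.
case=> // -[x e].
have [z ez] : child (g u) (g (rcons u y)) by apply: IH; exists y.
move: e; rewrite ez => /rcons_inj[/aut_inj euv _].
case: uv => t; rewrite -euv => /(congr1 size).
by rewrite !size_rcons => /eqP; rewrite -addn2 -[X in X == _]addn0 eqn_add2l.
Qed.

Lemma size_aut g v : size (g v) = size v.
Proof.
elim/last_ind: v => [|v x IH]; first by rewrite aut_root.
have [y ->] : child (g v) (g (rcons v x)) by apply: aut_child; exists x.
by rewrite !size_rcons IH.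
Qed.

Lemma aut_prefix g v w : exists w', g (v ++ w) = g v ++ w'.
Proof.
elim/last_ind: w => [|w x [w' e]]; first by exists [::]; rewrite !cats0.
have [y] : child (g (v ++ w)) (g (v ++ rcons w x)).
  by apply: aut_child; exists x; rewrite rcons_cat.
by rewrite e => ->; exists (rcons w' y); rewrite rcons_cat.
Qed.

(** Automorphisms act on the right, [g v] being [v^g]; hence
    [v^(g * h) = (v^g)^h], i.e. [(g * h) v = h (g v)]. *)

Lemma is_tree_aut_id : is_tree_aut idfun.
Proof. by split=> //; exists idfun. Qed.

Lemma is_tree_aut_comp g h : is_tree_aut (h \o g).
Proof.
have [gb g0 ga] := autP g; have [hb h0 ha] := autP h.
split=> [||u v]; first exact: bij_comp.
  by rewrite /= g0.
by rewrite ga ha.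
Qed.

Lemma aut_inv_ex g : exists f : vertex d -> vertex d, cancel g f /\ cancel f g.
Proof. by case: (autP g) => -[f gf fg] _ _; exists f. Qed.

Definition aut_inv_fun g := sval (cid (aut_inv_ex g)).

Lemma aut_funK g : cancel g (aut_inv_fun g).
Proof. by case: (svalP (cid (aut_inv_ex g))). Qed.

Lemma aut_inv_funK g : cancel (aut_inv_fun g) g.
Proof. by case: (svalP (cid (aut_inv_ex g))). Qed.

Lemma is_tree_aut_inv g : is_tree_aut (aut_inv_fun g).
Proof.
split=> [||u v].
- by exists g; [exact: aut_inv_funK|exact: aut_funK].
- by apply: (@aut_inj g); rewrite aut_inv_funK aut_root.
- have [_ _ ga] := autP g.
  by rewrite (ga (aut_inv_fun g u) (aut_inv_fun g v)) !aut_inv_funK.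
Qed.

Definition aut_one := TreeAut is_tree_aut_id.
Definition aut_mul g h := TreeAut (is_tree_aut_comp g h).
Definition aut_inv g := TreeAut (is_tree_aut_inv g).

Lemma aut_mulA : associative aut_mul.
Proof. by move=> g h k; exact: treeAut_eq. Qed.

Lemma aut_mul1g : left_id aut_one aut_mul.
Proof. by move=> g; exact: treeAut_eq. Qed.

Lemma aut_mulg1 : right_id aut_one aut_mul.
Proof. by move=> g; exact: treeAut_eq. Qed.

Lemma aut_mulVg : left_inverse aut_one aut_inv aut_mul.
Proof. by move=> g; apply: treeAut_eq => v /=; rewrite aut_inv_funK. Qed.

Lemma aut_mulgV : right_inverse aut_one aut_inv aut_mul.
Proof. by move=> g; apply: treeAut_eq => v /=; rewrite aut_funK. Qed.

HB.instance Definition _ := isGroup.Build treeAut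
  aut_mulA aut_mul1g aut_mulg1 aut_mulVg aut_mulgV.

(** * Sections and truncations *)

Definition section_fun g v : vertex d -> vertex d :=
  fun w => drop (size v) (g (v ++ w)).

Lemma cat_injr v : injective (cat v).
Proof. by move=> w w' /eqP; rewrite eqseq_cat// eqxx => /eqP. Qed.

Lemma section_funE g v w : g (v ++ w) = g v ++ section_fun g v w.
Proof.
have [w' e] := aut_prefix g v w.
by rewrite /section_fun e -(size_aut g v) drop_size_cat.
Qed.

Lemma child_cat2l v u w : child (v ++ u) (v ++ w) <-> child u w.
Proof.
split=> -[x e]; exists x; last by rewrite e rcons_cat.
by apply: (@cat_injr v); rewrite e rcons_cat.
Qed.

Lemma adjacent_cat2l v u w : adjacent (v ++ u) (v ++ w) <-> adjacent u w.
Proof. by rewrite /adjacent !child_cat2l. Qed.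

Lemma aut_invE g : cancel g (g^-1)%g.
Proof. exact: aut_funK. Qed.

Lemma is_tree_aut_section g v : is_tree_aut (section_fun g v).
Proof.
split=> [||u w].
- exists (section_fun (g^-1)%g (g v)) => w.
    apply: (@cat_injr v); rewrite -[X in X ++ _ = _](aut_invE g).
    by rewrite -section_funE -section_funE aut_invE.
  apply: (@cat_injr (g v)).
  rewrite -section_funE -[X in g (X ++ _)](aut_invE g v) -section_funE.
  exact: aut_inv_funK.
- by rewrite /section_fun cats0 -(size_aut g) drop_size.
- have [_ _ ga] := autP g.
  by rewrite -(adjacent_cat2l v u w) ga !section_funE adjacent_cat2l.
Qed.

Definition section g v : treeAut := TreeAut (is_tree_aut_section g v).

Lemma sectionE g v w : g (v ++ w) = g v ++ section g v w.
Proof. exact: section_funE. Qed.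

Lemma section_uniq g v h : (forall w, g (v ++ w) = g v ++ h w) -> h = section g v.
Proof.
move=> gh; apply: treeAut_eq => w.
by apply: (@cat_injr (g v)); rewrite -gh sectionE.
Qed.

(* [{bseq m of 'I_d}] is the set of vertices of the truncated tree T^m: the
   words of length at most m. The values of [trunc m] are automorphisms of
   T^m, seen as maps from T^m to itself. *)
Lemma size_trunc m g (v : {bseq m of 'I_d}) : size (g v) <= m.
Proof. by rewrite size_aut; exact: size_bseq. Qed.

Definition trunc m g (v : {bseq m of 'I_d}) : {bseq m of 'I_d} :=
  Bseq (size_trunc g v).
Arguments trunc : clear implicits.

(** * The congruence topology *)

Definition congruence_open (U : set treeAut) :=
  forall g, U g -> exists n, [set h | trunc n h = trunc n g] `<=` U.

Lemma congruence_openT : congruence_open setT.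
Proof. by move=> g _; exists 0%N. Qed.

Lemma trunc_le n m g h : n <= m -> trunc m g = trunc m h ->
  trunc n g = trunc n h.
Proof.
move=> nm e; apply/funext => v; apply/val_inj => /=.
have vm : size v <= m by rewrite (leq_trans _ nm)// size_bseq.
by move/(congr1 (fun f => bseqval (f (Bseq vm)))): e.
Qed.

Lemma congruence_openI : setI_closed congruence_open.
Proof.
move=> U V oU oV g [Ug Vg]; have [n nU] := oU _ Ug; have [m mV] := oV _ Vg.
exists (maxn n m) => h /= e; split.
  by apply: nU; apply: trunc_le e; exact: leq_maxl.
by apply: mV; apply: trunc_le e; exact: leq_maxr.
Qed.

Lemma congruence_open_bigcup (I : Type) (f : I -> set treeAut) :
  (forall i, congruence_open (f i)) -> congruence_open (\bigcup_i f i).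
Proof.
move=> fo g [i _ fig]; have [n nf] := fo i g fig.
by exists n => h /nf fih; exists i.
Qed.

HB.instance Definition _ := isOpenTopological.Build treeAut
  congruence_openT congruence_openI congruence_open_bigcup.

(** * Stabilizers, fractal and mixing groups *)

Implicit Types G H : set treeAut.

Definition stabV H v : set treeAut := [set h | H h /\ h v = v].

Definition stabL H n : set treeAut := \bigcap_(v in level n) stabV H v.

Definition sections_at H v : set treeAut :=
  [set section h v | h in stabV H v].

Definition trunc_sections_at H v m : set ({bseq m of 'I_d} -> {bseq m of 'I_d}) :=
  [set trunc m (section h v) | h in stabV H v].
Arguments trunc_sections_at : clear implicits.

Definition acts_transitively_on H (A : set (vertex d)) :=
  forall a, A a -> [set h a | h in H] = A.

Definition self_similar G := forall g v, G g -> G (section g v).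

Definition level_transitive G := forall n, acts_transitively_on G (level n).

Definition fractal G :=
  [/\ self_similar G, level_transitive G & forall v, sections_at G v = G].

(* N depends on m only. *)
Definition mixing G :=
  [/\ fractal G,
      forall n u k, 1 <= n -> level n u -> 1 <= k ->
        acts_transitively_on (stabL G n) [set u ++ w | w in level k] &
      forall m, 1 <= m -> exists N, forall n, 1 <= n ->
        forall v, n + N <= size v ->
          trunc_sections_at (stabL G n) v m = [set trunc m g | g in G]].

(** * Ends *)

Definition is_end (e : nat -> vertex d) :=
  e 0 = [::] /\ forall n, child (e n) (e n.+1).

Definition fixes_end g := exists2 e, is_end e & forall n, g (e n) = e n.

End Tree.

Arguments trunc {d} m g v.
Arguments trunc_sections_at {d} H v m _.

(** * Haar measure *)

(* The type of elements of a subgroup G of Aut(T), with the group structure and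
   the topology induced by Aut(T). *)
Definition subgroup_type d (G : set (treeAut d)) (gG : group_closed [in G]) :
  Type := set_type G.

Section SubgroupType.
Variables (d : nat) (G : set (treeAut d)) (gG : group_closed [in G]).

HB.instance Definition _ := SubChoice.on (subgroup_type gG).
HB.instance Definition _ :=
  SubChoice_isSubGroup.Build (treeAut d) [in G] (subgroup_type gG) gG.
HB.instance Definition _ := Topological.copy (subgroup_type gG) (set_type G).
HB.instance Definition _ := isPointed.Build (subgroup_type gG) 1%g.

End SubgroupType.

Definition borel (T : ptopologicalType) := g_sigma_algebraType (@open T).

Section Haar.
Variables (R : realType) (d : nat) (G : set (treeAut d)).
Variable gG : group_closed [in G].
Implicit Type mu : probability (borel (subgroup_type gG)) R.

(* A left-invariant Borel probability measure on G, i.e. the normalized Haar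
   measure when G is closed, hence compact. *)
Definition normalized_haar mu :=
  forall (g : subgroup_type gG) (A : set (subgroup_type gG)),
    measurable (A : set (borel (subgroup_type gG))) ->
    mu [set (g * x)%g | x in A] = mu A.

Definition FPP mu : \bar R :=
  mu [set g : subgroup_type gG | fixes_end (val g)].

End Haar.

(* Main.v *)
(** Let X_n(g) be the number of fixed vertices of g on level n. Condition (i) makes X_n
    a martingale for the filtration given by the cosets of St_G(n), so E X_n <= d for
    n >= 1. Fix r, and m with r < d ^ m. By condition (ii), on a coset of St_G(n) where
    0 < X_n <= r an element fixes some vertex v of level n + N + 1 together with all the
    vertices m levels below v, with a probability bounded below by a constant c > 0
    which does not depend on n; then X jumps above r. As E min(X_n, r) loses at least
    the mass of these jumps, E min(X_{n+M}, r) + c P(0 < X_n <= r) <= E min(X_n, r) with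
    M = N + 1 + m, so P(0 < X_n <= r) is arbitrarily small for suitable n. With
    P(X_n > r) <= d / (r + 1) this gives FPP(G) <= d / (r + 1) for every r. *)
Require Import Defs.
From HB Require Import structures.
From mathcomp Require Import all_boot all_order all_algebra.
From mathcomp Require Import all_classical all_reals all_analysis.

From mathcomp Require Import measurable_realfun.

Set Implicit Arguments.
Unset Strict Implicit.
Unset Printing Implicit Defensive.

Local Open Scope classical_set_scope.

(** * Agreement on a level, fixed vertices and fixed ends *)

Section TreeAutomorphisms.
Variable d : nat.
Implicit Types (g h : treeAut d) (u v w : vertex d).

Lemma aut_invK g : cancel (g^-1)%g g.
Proof. exact: aut_inv_funK. Qed.

Lemma cat_eq_size v v' w w' :
  size v = size v' -> v ++ w = v' ++ w' -> v = v' /\ w = w'.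
Proof. by move=> s /eqP; rewrite eqseq_cat// => /andP[/eqP -> /eqP ->]. Qed.

Lemma aut_fixed_prefix g v w : g (v ++ w) = v ++ w -> g v = v.
Proof. by rewrite sectionE => /cat_eq_size[]//; rewrite size_aut. Qed.

Lemma aut_fixed_cat g v w : g v = v -> exists2 w', size w' = size w &
  g (v ++ w) = v ++ w'.
Proof. by move=> gv; exists (section g v w); rewrite ?size_aut// sectionE gv. Qed.

Lemma aut_inv_fixed g v : g v = v -> (g^-1)%g v = v.
Proof. by move=> gv; rewrite -{1}gv aut_invE. Qed.

(** For [d > 0], equality on level [n] forces equality on all shorter words, so this is congruence
    modulo the level stabilizer. *)
Definition agree n g h := forall v, size v = n -> g v = h v.

Lemma agree_sym n g h : agree n g h -> agree n h g.
Proof. by move=> gh v /gh. Qed.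

Lemma agree_trans n g h k : agree n g h -> agree n h k -> agree n g k.
Proof. by move=> gh hk v vn; rewrite gh// hk. Qed.

Lemma agree_inv n g h : agree n g h -> agree n (g^-1)%g (h^-1)%g.
Proof.
move=> gh v vn; apply: (@aut_inj _ h); rewrite aut_invK -gh ?aut_invK//.
by rewrite size_aut.
Qed.

Lemma agree_section n u g h :
  agree (size u + n) g h -> agree n (section g u) (section h u).
Proof. by move=> gh v vn /=; rewrite /section_fun gh// size_cat vn. Qed.

Lemma agree_le n m g h : 0 < d -> n <= m -> agree m g h -> agree n g h.
Proof.
move=> d0 nm gh v vn.
have := gh (v ++ nseq (m - n) (Ordinal d0)).
rewrite size_cat size_nseq vn subnKC// => /(_ erefl).
by rewrite !sectionE => /cat_eq_size[]//; rewrite !size_aut.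
Qed.

Lemma agree_trunc n g h : trunc n g = trunc n h -> agree n g h.
Proof.
move=> gh v vn; have vle : size v <= n by rewrite vn.
by move/(congr1 (fun f => bseqval (f (Bseq vle)))): gh.
Qed.

Lemma size_aut_tuple n g (v : n.-tuple 'I_d) : size (g v) == n.
Proof. by rewrite size_aut size_tuple. Qed.

(** The action on level [n] becomes an element of a finite type, so that it can index finite
    partitions of the group. *)
Definition level_fun n g : {ffun n.-tuple 'I_d -> n.-tuple 'I_d} :=
  [ffun v => Tuple (size_aut_tuple g v)].

Lemma level_funP n g h : level_fun n g = level_fun n h <-> agree n g h.
Proof.
split=> [gh v /eqP vn|gh].
  by move/ffunP: gh => /(_ (Tuple vn)); rewrite !ffunE => /(congr1 val).
by apply/ffunP => v; rewrite !ffunE; apply/val_inj => /=; rewrite gh// size_tuple.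
Qed.

Definition fixcount n g : nat := #|[pred v : n.-tuple 'I_d | g v == v]|.

Lemma fixcount_sum n g :
  fixcount n g = (\sum_(v : n.-tuple 'I_d) (g v == v :> seq _))%N.
Proof.
rewrite /fixcount -sum1_card big_mkcond/=; apply: eq_bigr => v _.
by rewrite inE; case: (_ == _).
Qed.

Lemma agree_fixcount n g h : agree n g h -> fixcount n g = fixcount n h.
Proof.
move=> gh; rewrite !fixcount_sum; apply: eq_bigr => v _.
by rewrite gh// size_tuple.
Qed.

Lemma fixcount_gt0P n g :
  reflect (exists2 v, size v = n & g v = v) (0 < fixcount n g).
Proof.
apply: (iffP card_gt0P) => [[v /eqP gv]|[v vn gv]].
  by exists v => //; rewrite size_tuple.
by move/eqP in vn; exists (Tuple vn); rewrite inE /= gv.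
Qed.

Lemma fixcount_ge v m g : (forall w, size w = m -> g (v ++ w) = v ++ w) ->
  d ^ m <= fixcount (size v + m) g.
Proof.
move=> gw.
have sz (w : m.-tuple 'I_d) : size (v ++ w) == size v + m by rewrite size_cat size_tuple.
pose f (w : m.-tuple 'I_d) := Tuple (sz w).
have f_inj : injective f by move=> w w' /(congr1 val) /cat_injr /val_inj.
rewrite -[X in X ^ m](card_ord d) -card_tuple -(card_codom f_inj).
apply: subset_leq_card; apply/fintype.subsetP => _ /codomP[w ->].
by rewrite inE /= gw// size_tuple.
Qed.

Lemma fixcount_le n g : fixcount n g <= d ^ n.
Proof. by rewrite (leq_trans (max_card _))// card_tuple card_ord. Qed.

(* A word is extendable if it has fixed extensions of every length; by the pigeonhole
   principle such a word has an extendable child. *)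
Lemma fixes_endP g : fixes_end g <-> forall n, 0 < fixcount n g.
Proof.
split=> [[e [e0 ec] ge] n|gn].
  apply/fixcount_gt0P; exists (e n) => //.
  by elim: n => [|n IH]; rewrite ?e0//; have [x ->] := ec n; rewrite size_rcons IH.
pose ext v := forall k, exists2 w, size w = k & g (v ++ w) = v ++ w.
have ext0 : ext [::] by move=> k; apply/fixcount_gt0P.
have ext_child v : ext v -> exists x, ext (rcons v x).
  move=> ev; apply: contrapT => /forallNP nex.
  have /choice[K HK] : forall x, exists k,
      ~ exists2 w, size w = k & g (rcons v x ++ w) = rcons v x ++ w.
    by move=> x; apply/existsNP; exact: nex.
  (* The extra letter is the child [x]. The remaining length is at least [K x], so [w] can be cut to
     a fixed extension of length [K x], which the choice of [K] forbids. *)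
  have [[|x w]// [sw] gw] := ev (\max_x K x).+1.
  apply: (HK x); exists (take (K x) w).
    by rewrite size_takel// sw; exact: leq_bigmax.
  apply: (@aut_fixed_prefix _ _ (drop (K x) w)).
  by rewrite -catA cat_take_drop cat_rcons.
have /choice[f Hf] : forall v, exists x, ext v -> ext (rcons v x).
  (* After a word that is not extendable any letter will do; one is read off a fixed word of length
     1. *)
  move=> v; have [/ext_child[x ex]|nev] := pselect (ext v); first by exists x.
  have [[|x ?]// _ _] := ext0 1; by exists x.
pose e := fix e n := if n is m.+1 then rcons (e m) (f (e m)) else [::].
exists e; first by split=> // n; exists (f (e n)).
have ee n : ext (e n) by elim: n => [|n IH] //=; exact: Hf.
by move=> n; have [w /eqP/nilP-> ] := ee n 0; rewrite cats0.
Qed.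

End TreeAutomorphisms.

Import GRing.Theory Num.Theory Order.TTheory.

(** * Sums over concatenated words and finite measurable partitions *)

Lemma big_tuple_cat (X : finType) (V : nmodType) n k (F : seq X -> V) :
  (\sum_(v : (n + k).-tuple X) F v =
   \sum_(u : n.-tuple X) \sum_(w : k.-tuple X) F (u ++ w))%R.
Proof.
rewrite pair_bigA /=.
rewrite (reindex (fun p : n.-tuple X * k.-tuple X => cat_tuple p.1 p.2))//=.
have szt (v : (n + k).-tuple X) : size (take n v) == n.
  by rewrite size_takel// size_tuple leq_addr.
have szd (v : (n + k).-tuple X) : size (drop n v) == k.
  by rewrite size_drop size_tuple addKn.
exists (fun v : (n + k).-tuple X => (Tuple (szt v), Tuple (szd v))) => [[u w] _|v _].
  congr (_, _); apply: val_inj => /=.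
    by rewrite take_size_cat// size_tuple.
  by rewrite drop_size_cat// size_tuple.
by apply: val_inj; rewrite /= cat_take_drop.
Qed.

Section FinitePartition.
Variables (disp : measure_display) (T : measurableType disp) (R : realType).
Variables (mu : {measure set T -> \bar R}%R) (I : finType) (c : T -> I).
Hypothesis mc : forall i, measurable (c @^-1` [set i]).

Lemma ge0_integral_partition (D : set T) (f : T -> \bar R) : measurable D ->
  measurable_fun D f -> (forall x, D x -> (0 <= f x)%E) ->
  (\int[mu]_(x in D) f x = \sum_i \int[mu]_(x in D `&` c @^-1` [set i]) f x)%E.
Proof.
move=> mD mf f0.
have DE : D = \big[setU/set0]_(i <- index_enum I) (D `&` c @^-1` [set i]).
  rewrite -bigcup_seq; apply/seteqP; split=> [x Dx|x [i _ []]//].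
  by exists (c x) => //=; rewrite mem_index_enum.
rewrite {1}DE ge0_integral_bigsetU//=.
- by move=> i; exact: measurableI.
- exact: index_enum_uniq.
- apply/trivIsetP => i j _ _ /eqP ij; apply/seteqP; split=> // x [[_ /= ci] [_ /= cj]];
  by case: ij; rewrite -ci -cj.
- by rewrite -DE.
- by rewrite -DE.
Qed.

Lemma measure_partition (D : set T) : measurable D ->
  (mu D = \sum_i mu (D `&` c @^-1` [set i]))%E.
Proof.
move=> mD; rewrite -[LHS]mul1e -integral_cst// ge0_integral_partition//.
by apply: eq_bigr => i _; rewrite integral_cst ?mul1e//; exact: measurableI.
Qed.

End FinitePartition.

(** * Haar measure and cosets of the level stabilizers *)

Section Haar.
Variables (R : realType) (d : nat) (d_gt0 : 0 < d).
Variables (G : set (treeAut d)) (gG : group_closed [in G]).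
Variables (mu : probability (borel (subgroup_type gG)) R).
Hypothesis haar_mu : normalized_haar mu.
Local Notation T := (subgroup_type gG).
Implicit Types (u v w : vertex d) (g x y : T).

Definition level_determined n (A : set T) :=
  forall g h : T, agree n (val g) (val h) -> A g -> A h.

(** Such a set is a union of cosets of the open level stabilizer, hence open. *)
Lemma measurable_level_determined n (A : set T) :
  level_determined n A -> measurable (A : set (borel T)).
Proof.
move=> dA; apply: sub_sigma_algebra.
(* An open set of Aut(T) whose trace on [G] is [A], as the induced topology requires. *)
exists [set g | exists2 h : T, A h & agree n (val h) g].
  move=> g [h Ah hg]; exists n => k /= /agree_trunc kg.
  by exists h => //; apply: agree_trans hg _; exact: agree_sym.
apply/seteqP; split=> g /=; first by move=> [h Ah hg]; exact: dA Ah.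
by move=> Ag; exists g.
Qed.

Lemma measurable_fun_level_determined n (D : set (borel T)) (f : borel T -> \bar R) :
  measurable D ->
  (forall g h : T, agree n (val g) (val h) -> f g = f h) -> measurable_fun D f.
Proof.
move=> mD df _ Y _; apply: measurableI => //.
apply: (@measurable_level_determined n) => g h gh.
by rewrite /preimage /= (df _ _ gh).
Qed.

Lemma haar_preimage_lmul (t : T) (A : set T) : measurable (A : set (borel T)) ->
  mu [set x | A (t * x)%g] = mu A.
Proof.
move=> mA; rewrite -(haar_mu (t^-1)%g mA); congr (mu _).
apply/seteqP; split=> x /=.
  by move=> Ax; exists (t * x)%g => //; rewrite mulKg.
by move=> [y Ay <-]; rewrite mulVKg.
Qed.

Definition coset n (g : T) : set T := [set x | agree n (val g) (val x)].

Lemma measurable_coset n g : measurable (coset n g : set (borel T)).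
Proof.
by apply: (@measurable_level_determined n) => x y xy gx; apply: agree_trans xy.
Qed.

(** This replaces conditioning on level [n]: the cosets form a finite partition, so inequalities on
    single cosets add up. *)
Lemma le_integral_cosets n (f f' : borel T -> \bar R) :
  (forall x, (0 <= f x)%E) -> (forall x, (0 <= f' x)%E) ->
  measurable_fun setT f -> measurable_fun setT f' ->
  (forall g, \int[mu]_(x in coset n g) f x <= \int[mu]_(x in coset n g) f' x)%E ->
  (\int[mu]_x f x <= \int[mu]_x f' x)%E.
Proof.
move=> f0 f'0 mf mf' ff'.
pose c (x : borel T) := level_fun n (val (x : T)).
have cP (x y : T) : c x = c y <-> agree n (val x) (val y) by exact: level_funP.
have mc a : measurable (c @^-1` [set a]).
  by apply: (@measurable_level_determined n) => x y /cP; rewrite /= => ->.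
rewrite !(ge0_integral_partition mu mc)//; apply: lee_sum => a _.
(* A level map that no element of [G] induces has an empty class. *)
rewrite setTI; have [[x xa]|nx] := pselect (exists x, c x = a).
  have -> : c @^-1` [set a] = coset n x.
    apply/seteqP; split=> y; rewrite -xa; first by move=> /cP/agree_sym.
    by move=> /agree_sym/cP.
  exact: ff'.
have -> : c @^-1` [set a] = set0 by apply/seteqP; split=> // x xa; apply: nx; exists x.
by rewrite !integral_set0.
Qed.

Lemma val_lmul (h x : T) v : val (h * x)%g v = val x (val h v).
Proof. by rewrite valM. Qed.

Lemma val_inv (h : T) : val (h^-1)%g = (val h)^-1%g.
Proof. exact: gmulfV. Qed.

Lemma level_determined_lmul n (t : T) (A : set T) :
  level_determined n A -> level_determined n [set x | A (t * x)%g].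
Proof.
move=> dA x y xy; apply: dA => v vn.
by rewrite !val_lmul xy// size_aut.
Qed.

Lemma coset_lmul n (g h x : T) : agree n 1%g (val h) ->
  coset n g (h * x)%g <-> coset n g x.
Proof.
move=> h1; have xE v : size v = n -> val (h * x)%g v = val x v.
  by move=> vn; rewrite val_lmul -h1.
by split=> gx v vn; rewrite gx// xE.
Qed.

Lemma coset_fixcount n (g x : T) : coset n g x ->
  fixcount n (val x) = fixcount n (val g).
Proof. by move=> /agree_fixcount. Qed.

(** * Condition (i): the number of fixed vertices as a martingale *)

Hypothesis stab_transitive : forall n u k, 1 <= n -> level n u -> 1 <= k ->
  acts_transitively_on (stabL G n) [set u ++ w | w in level k].

(** The word [u] witnesses that level [n] is inhabited; this is how membership in the intersection
    [stabL G n] yields membership in [G]. *)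
Lemma stabL_subgroup_type n u (h : treeAut d) : size u = n -> stabL G n h ->
  exists2 h' : T, agree n 1%g (val h') & val h' = h.
Proof.
move=> un Hh; have [Gh _] := Hh u un.
exists (Sub h (mem_set Gh) : T); last by rewrite SubK.
by move=> v vn; rewrite SubK; have [_ ->] := Hh v vn.
Qed.

Lemma exists_stab_moving n u (w w' : vertex d) : 1 <= n -> size u = n ->
  1 <= size w -> size w' = size w ->
  exists2 h : T, agree n 1%g (val h) & val h (u ++ w) = u ++ w'.
Proof.
move=> n1 un w1 sw.
have [] : [set h (u ++ w) | h in stabL G n] (u ++ w').
  rewrite (@stab_transitive n u (size w))//; last by exists w.
  by exists w'.
move=> h /(stabL_subgroup_type un) [h' h'1 <-] hE; by exists h'.
Qed.

Definition fixing (v : vertex d) : set T := [set x : T | val x v = v].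

Lemma measurable_fixing v : measurable (fixing v : set (borel T)).
Proof.
by apply: (@measurable_level_determined (size v)) => x y xy; rewrite /fixing/= xy.
Qed.

(** Fix a word [w0]. If [h] in the level stabilizer sends [u ++ w] to [u ++ w0], then [h * x] fixes
    [u ++ w] exactly when [x] sends [u ++ w0] to [u ++ w]. By invariance the summands are the
    measures of these latter events, which partition the coset by the image of [w0]. *)
Lemma sum_measure_fixing_extensions n k (g : T) u : 1 <= n -> 1 <= k -> size u = n ->
  val g u = u ->
  (\sum_(w : k.-tuple 'I_d) mu (coset n g `&` fixing (u ++ w)) = mu (coset n g))%E.
Proof.
move=> n1 k1 un gu.
pose w0 := nseq k (Ordinal d_gt0).
have sz (x : T) : size (section (val x) u w0) == k by rewrite size_aut size_nseq.
pose c (x : borel T) : k.-tuple 'I_d := Tuple (sz x).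
have cP (x : T) (w : k.-tuple 'I_d) : coset n g x ->
    (c x = w <-> val x (u ++ w0) = u ++ w).
  move=> gx; rewrite sectionE -gx// gu; split=> [<-//|/cat_injr e].
  by apply: val_inj => /=; rewrite -e.
have mc (w : k.-tuple 'I_d) : measurable (c @^-1` [set w]).
  apply: (@measurable_level_determined (n + k)) => x y xy /= <-.
  by apply: val_inj => /=; rewrite /section_fun xy// size_cat un size_nseq.
rewrite [RHS](measure_partition mu mc); last exact: measurable_coset.
apply: eq_bigr => w _.
have [||h h1 hE] := @exists_stab_moving n u w w0 n1 un.
- by rewrite size_tuple.
- by rewrite size_nseq size_tuple.
rewrite -(haar_preimage_lmul h); last first.
  by apply: measurableI; [exact: measurable_coset|exact: measurable_fixing].
have hxE (x : T) : val (h * x)%g (u ++ w) = val x (u ++ w0).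
  by rewrite val_lmul hE.
congr (mu _); apply/seteqP; split=> x [gx xw]; split.
- exact/(coset_lmul g x h1).
- by apply/cP; [exact/(coset_lmul g x h1)|rewrite -hxE].
- exact/(coset_lmul g x h1).
- by rewrite /fixing /mkset hxE; exact/cP.
Qed.

Lemma measurable_fixcount n m (D : set (borel T)) (f : nat -> nat -> R) : n <= m ->
  measurable D ->
  measurable_fun D (fun x : borel T =>
    (f (fixcount n (val (x : T))) (fixcount m (val (x : T))))%:E).
Proof.
move=> nm mD; apply: (@measurable_fun_level_determined m) => // g h gh.
by rewrite (agree_fixcount gh) (agree_fixcount (agree_le d_gt0 nm gh)).
Qed.

(** The martingale property on one coset: only extensions of vertices [u] fixed by [g] contribute,
    and those of one such [u] contribute the measure of the coset in total. *)
Lemma integral_coset_fixcount n k (g : T) : 1 <= n -> 1 <= k ->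
  (\int[mu]_(x in coset n g) (fixcount (n + k) (val (x : T)))%:R%:E =
   (fixcount n (val g))%:R%:E * mu (coset n g))%E.
Proof.
move=> n1 k1.
under eq_integral do rewrite fixcount_sum natr_sum -sumEFin.
rewrite ge0_integral_sum//; first last.
- move=> v; apply: (@measurable_fun_level_determined (n + k)).
    exact: measurable_coset.
  by move=> x y xy; rewrite xy// size_tuple.
- exact: measurable_coset.
have E v : (\int[mu]_(x in coset n g) (val (x : T) v == v)%:R%:E =
            mu (coset n g `&` fixing v))%E.
  rewrite setIC -integral_indic; first last.
  - exact: measurable_fixing.
  - exact: measurable_coset.
  apply: eq_integral => x _; rewrite indicE; congr (_%:R%:E)%R.
  by congr nat_of_bool; apply/eqP/idP => [xv|/set_mem//]; exact/mem_set.
under eq_bigr do rewrite E.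
rewrite (@big_tuple_cat _ _ n k (fun v => mu (coset n g `&` fixing v))).
rewrite fixcount_sum natr_sum -sumEFin ge0_sume_distrl//.
apply: eq_bigr => u _; case: eqP => [gu|ngu].
  by rewrite mul1e sum_measure_fixing_extensions// size_tuple.
rewrite mul0e big1// => w _; rewrite (_ : _ `&` _ = set0) ?measure0//.
apply/seteqP; split=> // x [gx /aut_fixed_prefix]; rewrite -gx ?size_tuple//.
Qed.

(** * Condition (ii): jumps above r and the loss of the truncated mean *)

Hypothesis G_self_similar : self_similar G.

(** Correct [g] twice inside its coset: [k] brings the image of [v] back to [v], and [l] fixes [v]
    with a section that inverts, down to depth [m], the section [s] of [g * k] at [v].
    Self-similarity puts [s] in [G], so condition (ii) supplies [l]. *)
Lemma exists_section_trivial n m N g u w : 1 <= n -> 1 <= size w ->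
  N <= size w -> size u = n -> val g u = u ->
  (forall v, n + N <= size v ->
    trunc_sections_at (stabL G n) v m = [set trunc m g | g in G]) ->
  exists2 h : T, coset n g h &
    forall z, size z = m -> val h ((u ++ w) ++ z) = (u ++ w) ++ z.
Proof.
move=> n1 w1 Nw un gu secs; set v := u ++ w.
have [w' sw' gv] := aut_fixed_cat w gu.
have [||k k1 kv] := @exists_stab_moving n u w' w n1 un; rewrite ?sw'//.
have gkv : val (g * k)%g v = v by rewrite val_lmul gv kv.
pose s := section (val (g * k)%g) v.
have Gs : G (s^-1)%g.
  apply: set_mem; apply: (group_closedV gG); apply: mem_set.
  exact/G_self_similar/set_mem/valP.
have := secs v; rewrite size_cat un leq_add2l => /(_ Nw)/seteqP[_ /(_ (trunc m (s^-1)%g))].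
case; first by exists (s^-1)%g.
move=> _ [/(stabL_subgroup_type un)[l l1 <-] lv] /agree_trunc ls.
exists (g * k * l)%g.
  by move=> z zn; rewrite !val_lmul -l1 ?size_aut// -k1 ?size_aut.
move=> z zm; rewrite val_lmul sectionE gkv sectionE lv; congr (_ ++ _).
by rewrite ls ?size_aut// aut_invE.
Qed.

Definition classes N m :=
  #|{: N.+1.-tuple 'I_d * {ffun m.-tuple 'I_d -> m.-tuple 'I_d}}|.

Lemma classes_gt0 N m : 0 < classes N m.
Proof. by apply/card_gt0P; exists (nseq_tuple N.+1 (Ordinal d_gt0), [ffun z => z]). Qed.

(* Classify x in the coset by the vertex x^-1 v, where v = u ++ w0, and the section of
   x there; the number of classes does not depend on n. Any two elements of a class
   differ by a left translation, so each class can be translated into the set of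
   elements of the coset fixing v with trivial section at v. *)
Lemma measure_coset_le_fixcount_large n m N r g : 1 <= n -> r < d ^ m ->
  (forall v, n + N <= size v ->
    trunc_sections_at (stabL G n) v m = [set trunc m g | g in G]) ->
  0 < fixcount n (val g) ->
  (mu (coset n g) <=
   (classes N m)%:R%:E *
   mu (coset n g `&` [set x : T | (r < fixcount (n + (N.+1 + m)) (val x))%N]))%E.
Proof.
move=> n1 rm secs /fixcount_gt0P[u un gu].
set E := coset n g `&` _.
have dE : level_determined (n + (N.+1 + m)) E.
  move=> x y xy [gx]; rewrite /mkset (agree_fixcount xy) => rx; split=> //.
  by apply: agree_trans gx _; apply: agree_le xy => //; rewrite leq_addr.
have mE : measurable (E : set (borel T)) by exact: measurable_level_determined dE.
(* Length [N.+1] rather than [N], because condition (i) needs a nonempty word below [u]. *)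
pose w0 := nseq N.+1 (Ordinal d_gt0); pose v := u ++ w0.
have sv : size v = n + N.+1 by rewrite size_cat un size_nseq.
have [||g1 gg1 g1v] := @exists_section_trivial n m N g u w0 n1 _ _ un gu secs.
- by rewrite size_nseq.
- by rewrite size_nseq.
have sz (x : T) : size (section (val x)^-1%g u w0) == N.+1.
  by rewrite size_aut size_nseq.
pose c (x : borel T) :=
  (Tuple (sz x), level_fun m (section (val (x : T)) (u ++ Tuple (sz x)))).
have cE (x y : T) : c x = c y -> section (val x)^-1%g u w0 = section (val y)^-1%g u w0 /\
    agree m (section (val x) (u ++ section (val x)^-1%g u w0))
            (section (val y) (u ++ section (val x)^-1%g u w0)).
  case=> e /level_funP; rewrite /= => xy; split=> //.
  by move: xy; rewrite /= -e.
have mc i : measurable (c @^-1` [set i]).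
  apply: (@measurable_level_determined (n + (N.+1 + m))) => x y xy <-.
  have e : Tuple (sz y) = Tuple (sz x).
    apply: val_inj; apply/esym; apply: (@agree_section _ N.+1 u).
      by apply/agree_inv; apply: agree_le xy => //; rewrite un addnA leq_addr.
    by rewrite size_nseq.
  congr (_, _) => //; rewrite e; apply/level_funP/agree_section/agree_sym.
  by rewrite size_cat size_tuple un -addnA.
rewrite (measure_partition mu mc); last exact: measurable_coset.
rewrite /classes -sum1_card natr_sum -sumEFin ge0_sume_distrl//.
apply: lee_sum => i _; rewrite mul1e.
have [[g2 [gg2 g2i]]|nx] := pselect (exists x, (coset n g `&` c @^-1` [set i]) x);
  last first.
  rewrite (_ : _ `&` _ = set0) ?measure0//.
  by apply/seteqP; split=> // x xi; apply: nx; exists x.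
(* With [g2] a representative of the class, left translation by [t] carries [g2] to [g1] and the
   whole class into [E]. *)
pose t : T := (g1 * g2^-1)%g.
have tE (x : T) z : val (t * x)%g z = val x ((val g2)^-1%g (val g1 z)).
  by rewrite !val_lmul val_inv.
have t1 : agree n 1%g (val t).
  by move=> z zn; rewrite val_lmul val_inv -gg1// gg2// aut_invE.
rewrite -(haar_preimage_lmul t mE); apply: le_measure; rewrite ?inE.
- by apply: measurableI => //; exact: measurable_coset.
- apply: measurable_level_determined; exact: (level_determined_lmul dE).
move=> x [gx xi]; split; first exact/(coset_lmul g x t1).
have [e xg2] := cE x g2 (etrans xi (esym g2i)).
set w := section _ u w0 in e xg2.
have xv (y : T) : coset n g y -> section (val y)^-1%g u w0 = w -> (val y)^-1%g v = u ++ w.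
  by move=> gy <-; rewrite sectionE aut_inv_fixed// -gy.
apply: (leq_trans rm); rewrite addnA -sv; apply: fixcount_ge => z zm.
(* After [g1] fixes [v ++ z], the inverse of [g2] moves it below [u ++ w]. There [x] acts to depth
   [m] as [g2] does, since both lie in one class, so it brings the word back to [v ++ z]. *)
rewrite tE g1v//; have := aut_invK (val g2) (v ++ z).
rewrite sectionE (xv _ gg2 (esym e)) sectionE.
rewrite -{1}(xv _ gg2 (esym e)) aut_invK => <-.
rewrite sectionE -{1}(xv _ gx erefl) aut_invK; congr (_ ++ _).
by apply: xg2; rewrite size_aut.
Qed.

Lemma measurable_fixcount_pred n (P : pred nat) :
  measurable ([set x : T | P (fixcount n (val x))] : set (borel T)).
Proof.
apply: (@measurable_level_determined n) => x y xy.
by rewrite /mkset (agree_fixcount xy).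
Qed.

Lemma integral_coset_cst n g (f : borel T -> \bar R) a :
  (forall x, coset n g x -> f x = a) ->
  (\int[mu]_(x in coset n g) f x = a * mu (coset n g))%E.
Proof.
move=> fa; rewrite -integral_cst; last exact: measurable_coset.
by apply: eq_integral => x /set_mem /fa.
Qed.

(* The martingale truncated at r is a supermartingale, and it loses the mass of the
   paths which jump above r. *)
Lemma truncated_fixcount_decrease n m N r : 1 <= n -> r < d ^ m ->
  (forall v, n + N <= size v ->
    trunc_sections_at (stabL G n) v m = [set trunc m g | g in G]) ->
  (\int[mu]_x (minn (fixcount (n + (N.+1 + m)) (val (x : T))) r)%:R%:E +
   ((classes N m)%:R^-1)%:E * mu [set x : T | (0 < fixcount n (val x) <= r)%N] <=
   \int[mu]_x (minn (fixcount n (val (x : T))) r)%:R%:E)%E.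
Proof.
move=> n1 rm secs; set c : R := ((classes N m)%:R^-1)%R; set M := (N.+1 + m)%N.
have c0 : (0 <= c)%R by rewrite invr_ge0.
pose A := [set x : T | (0 < fixcount n (val x) <= r)%N].
have mA : measurable (A : set (borel T)).
  exact: (measurable_fixcount_pred n (fun k => 0 < k <= r)).
(* The probability is written as an integral so that the claim can be checked coset by coset. *)
have -> : (c%:E * mu A = \int[mu]_x (c * (0 < fixcount n (val (x : T)) <= r)%N%:R)%:E)%E.
  rewrite -[X in mu X]setIT -integral_indic// -ge0_integralZl//; last first.
    exact/measurable_EFinP/measurable_indic.
  apply: eq_integral => x _; rewrite indicE EFinM; congr (_ * (nat_of_bool _)%:R%:E)%E.
  by apply/idP/idP => [/set_mem//|]; exact: mem_set.
have nM : n <= n + M by rewrite leq_addr.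
have mf (D : set (borel T)) f : measurable D -> measurable_fun D (fun x : borel T =>
    (f (fixcount n (val (x : T))) (fixcount (n + M) (val (x : T))))%:E : \bar R).
  exact: measurable_fixcount.
have m1 D mD := mf D (fun _ k => (minn k r)%:R%R) mD.
have m2 D mD := mf D (fun k _ => (c * (0 < k <= r)%N%:R)%R) mD.
have m3 D mD := mf D (fun k _ => (minn k r)%:R%R) mD.
have m4 D mD := mf D (fun _ k => (r < k)%N%:R%R) mD.
have m5 D mD := mf D (fun _ k => k%:R%R) mD.
have p0 (x : borel T) : (0 <= (c * (0 < fixcount n (val (x : T)) <= r)%N%:R)%:E)%E.
  by rewrite lee_fin mulr_ge0.
have mT : measurable (setT : set (borel T)) by exact: measurableT.
rewrite -ge0_integralD//; [|exact: m1|exact: m2].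
apply: (@le_integral_cosets n) => //.
- by move=> x; rewrite adde_ge0.
- by apply: emeasurable_funD; [exact: m1|exact: m2].
- exact: m3.
move=> g; have mC : measurable (coset n g : set (borel T)) by exact: measurable_coset.
rewrite ge0_integralD//; [|exact: m1|exact: m2].
set s := fixcount n (val g); set C := coset n g in mC *.
rewrite [X in (_ + X <= _)%E](@integral_coset_cst n g _ (c * (0 < s <= r)%N%:R)%:E); last first.
  by move=> x /coset_fixcount ->.
rewrite [leRHS](@integral_coset_cst n g _ (minn s r)%:R%:E); last first.
  by move=> x /coset_fixcount ->.
rewrite -/C.
have [rs|sr] := ltnP r s.
  rewrite andbF mulr0 mul0e adde0 -integral_cst//.
  apply: ge0_le_integral => //; first exact: m1.
  by move=> x _; rewrite lee_fin ler_nat geq_minr.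
(* Here [s <= r], so the truncation is inactive at level [n] and the right side is the untruncated
   mean at level [n + M]. *)
rewrite andbT -(@integral_coset_fixcount n M g)//.
pose E := [set x : T | (r < fixcount (n + M) (val x))%N].
have mE : measurable (E : set (borel T)).
  exact: (measurable_fixcount_pred (n + M) (ltn r)).
have cE : ((c * (0 < s)%N%:R)%:E * mu C <= mu (C `&` E))%E.
  have [s0|_] := ltnP 0 s; last by rewrite mulr0 mul0e.
  have := measure_coset_le_fixcount_large n1 rm secs s0.
  rewrite mulr1 -/M -/E -/C => CE.
  rewrite lee_pdivrMl ?ltr0n ?classes_gt0//.
(* Pointwise, min(k, r) plus the indicator of [r < k] is at most k. *)
apply: (@le_trans _ _ (\int[mu]_(x in C) ((minn (fixcount (n + M) (val (x : T))) r)%:R%:E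
     + (r < fixcount (n + M) (val (x : T)))%N%:R%:E))%E).
  rewrite ge0_integralD//; [|exact: m1|exact: m4].
  rewrite leeD2l// (le_trans cE)// setIC -integral_indic//.
  rewrite le_eqVlt; apply/orP; left; apply/eqP.
  apply: eq_integral => x _; rewrite indicE; congr ((nat_of_bool _)%:R%:E)%E.
  by apply/idP/idP => [/set_mem//|]; exact: mem_set.
apply: ge0_le_integral => //.
- by move=> x _; rewrite adde_ge0.
- by apply: emeasurable_funD; [exact: m1|exact: m4].
- exact: m5.
move=> x _; rewrite -EFinD lee_fin -natrD ler_nat.
case: ltnP => [rk|kr]; last by rewrite addn0.
by rewrite addn1.
Qed.

(** * First moment bound and the estimate of FPP at one level *)

Lemma measurable_fixcount1 n (D : set (borel T)) (f : nat -> R) : measurable D ->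
  measurable_fun D (fun x : borel T => (f (fixcount n (val (x : T))))%:E).
Proof. by move=> mD; exact: (@measurable_fixcount n n D (fun _ => f)). Qed.

(** The martingale starts at level 1, where the count is at most [d] pointwise. *)
Lemma integral_fixcount_le n : 1 <= n ->
  (\int[mu]_x (fixcount n (val (x : T)))%:R%:E <= d%:R%:E)%E.
Proof.
have mX k := @measurable_fixcount1 k setT (fun j => j%:R%R) measurableT.
have X1 : (\int[mu]_x (fixcount 1 (val (x : T)))%:R%:E <= d%:R%:E)%E.
  have -> : (d%:R%:E = \int[mu]_x (cst d%:R%:E) (x : borel T) :> \bar R)%E.
    by rewrite integral_cst// [X in (_ * X)%E]probability_setT mule1.
  apply: ge0_le_integral => //.
  by move=> x _; rewrite lee_fin ler_nat (leq_trans (fixcount_le _ _))// expn1.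
case: n => [//|[//|k]] _; apply: le_trans X1.
apply: (@le_integral_cosets 1) => // g.
rewrite -[X in fixcount X]add1n integral_coset_fixcount//.
by rewrite (@integral_coset_cst 1 g _ (fixcount 1 (val g))%:R%:E)// => x /coset_fixcount ->.
Qed.

(** Markov's inequality at the threshold [r.+1]. *)
Lemma measure_fixcount_gt r n : 1 <= n ->
  (r.+1%:R%:E * mu [set x : T | (r < fixcount n (val x))%N] <= d%:R%:E)%E.
Proof.
move=> n1; apply: le_trans (integral_fixcount_le n1).
have mE := measurable_fixcount_pred n (ltn r).
rewrite -[X in mu X]setIT -integral_indic// -ge0_integralZl//; last first.
  exact/measurable_EFinP/measurable_indic.
apply: ge0_le_integral => //.
- apply: emeasurable_funM => //; exact/measurable_EFinP/measurable_indic.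
- exact: (@measurable_fixcount1 n setT (fun j => j%:R%R)).
move=> x _; rewrite indicE -EFinM lee_fin.
have [/set_mem rx|_] := boolP (x \in _); last by rewrite mulr0.
by rewrite mulr1 ler_nat.
Qed.

Lemma measurable_fixes_end :
  measurable ([set g : T | fixes_end (val g)] : set (borel T)).
Proof.
have -> : [set g : T | fixes_end (val g)] =
    \bigcap_k [set x : T | (0 < fixcount k (val x))%N].
  apply/seteqP; split=> x; first by move=> /fixes_endP Fx k _; exact: Fx.
  by move=> Fx; apply/fixes_endP => k; exact: (Fx k I).
by apply: bigcapT_measurable => k; exact: (measurable_fixcount_pred k (ltn 0)).
Qed.

(** A fixed end gives a fixed vertex on level [n]; the positive counts are split at [r]. *)
Lemma FPP_le r n : 1 <= n ->
  (FPP mu <= mu [set x : T | (0 < fixcount n (val x) <= r)%N] + (d%:R / r.+1%:R)%:E)%E.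
Proof.
move=> n1.
have mP k P := measurable_fixcount_pred k P.
have mF := measurable_fixes_end.
set A := [set x : T | (0 < _ <= r)%N]; pose B := [set x : T | (r < fixcount n (val x))%N].
have mA : measurable (A : set (borel T)) by exact: (mP n (fun k => 0 < k <= r)).
have mB : measurable (B : set (borel T)) by exact: (mP n (ltn r)).
apply: (@le_trans _ _ (mu (A `|` B))).
  apply: le_measure; rewrite ?inE//; first exact: measurableU.
  move=> x /fixes_endP /(_ n) x0.
  by have [xr|rx] := leqP (fixcount n (val x)) r; [left; apply/andP|right].
apply: (le_trans (measureU2 _ mA mB)); rewrite leeD2l//.
by rewrite mulrC EFinM lee_pdivlMl// measure_fixcount_gt.
Qed.

End Haar.

(** * Iteration along the levels and the limit in r *)

Theorem theoremD (R : realType) (d : nat) (hd : (2 <= d)%N)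
  (G : set (treeAut d)) (gG : group_closed [in G])
  (closedG : closed G) (mixG : mixing G)
  (mu : probability (borel (subgroup_type gG)) R)
  (haar_mu : normalized_haar mu) :
  FPP mu = 0%E.
Proof.
have [[selfG _ _] transG secG] := mixG.
have d0 : 0 < d by exact: leq_trans hd.
have FPPfin : FPP mu \is a fin_num.
  by apply: fin_num_measure; exact: measurable_fixes_end.
suff FPP0 r : (FPP mu <= (d%:R / r.+1%:R)%:E)%E.
  move: FPP0; rewrite -(fineK FPPfin); set p := fine _ => p_le; congr EFin.
  have p0 : (0 <= p)%R by rewrite fine_ge0.
  apply/eqP; rewrite eq_le p0 andbT leNgt; apply/negP => p_gt0.
  have q0 : (0 <= d%:R / p)%R by rewrite divr_ge0.
  have := p_le (Num.Def.archi_bound (d%:R / p)); rewrite lee_fin leNgt => /negP; apply.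
  rewrite ltr_pdivrMr// mulrC -ltr_pdivrMr//.
  by rewrite (lt_le_trans (archi_boundP q0))// ler_nat.
(* The depth is taken to be m = [r.+1], which suffices because [d] is at least 2. *)
have rm : r < d ^ r.+1 by rewrite (ltn_trans (ltnSn r))// ltn_expl.
have [N secN] := secG r.+1 isT.
set M := (N.+1 + r.+1)%N; set c : R := ((classes d N r.+1)%:R^-1)%R.
have c0 : (0 < c)%R by rewrite invr_gt0 ltr0n classes_gt0.
(* Truncated means along levels spaced by [M], starting at level 1; [N] does not depend on the
   level, so one constant [c] serves all steps. *)
pose e j := (\int[mu]_x (minn (fixcount (1 + j * M)
  (val (x : subgroup_type gG))) r)%:R%:E)%E.
have e0 j : (0 <= e j)%E by apply: integral_ge0.
have e_le j : (e j <= r%:R%:E)%E.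
  have -> : (r%:R%:E = \int[mu]_x (cst r%:R%:E) (x : borel (subgroup_type gG)) :> \bar R)%E.
    by rewrite integral_cst// [X in (_ * X)%E]probability_setT mule1.
  apply: ge0_le_integral => //.
    exact: (@measurable_fixcount1 R d d0 G gG _ setT (fun k => (minn k r)%:R%R)).
  by move=> x _; rewrite lee_fin ler_nat geq_minr.
have efin j : e j \is a fin_num by rewrite ge0_fin_numE// (le_lt_trans (e_le j))// ltry.
rewrite -(fineK FPPfin) lee_fin leNgt; apply/negP; set p := fine _ => dp.
set q : R := (d%:R / r.+1%:R)%R in dp.
(* If [p] exceeded [q], then by [FPP_le] the event of a positive count at most [r] would have
   measure at least [p - q] on every level, so each step would lose at least [c * (p - q)]. *)
have decr j : (fine (e j.+1) + c * (p - q) <= fine (e j))%R.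
  have j1 : 1 <= 1 + j * M by [].
  have := truncated_fixcount_decrease d0 haar_mu transG selfG j1 rm (secN _ j1).
  rewrite -/M -/c -addnA [(j * M + M)%N]addnC -mulSn -/(e j.+1) -/(e j).
  have := FPP_le d0 haar_mu transG r j1.
  pose A := [set x : subgroup_type gG | (0 < fixcount (1 + j * M) (val x) <= r)%N].
  rewrite -/A.
  have Afin : mu A \is a fin_num.
    apply: fin_num_measure.
    exact: (measurable_fixcount_pred (1 + j * M) (fun k => 0 < k <= r)).
  rewrite -/q -(fineK FPPfin) -/p -(fineK Afin) -(fineK (efin j)) -(fineK (efin j.+1)).
  rewrite -EFinM -!EFinD !lee_fin => pA; apply: le_trans.
  by rewrite lerD2l ler_pM2l// lerBlDr.
have bound j : (fine (e j) + j%:R * (c * (p - q)) <= fine (e 0))%R.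
  elim: j => [|j IH]; first by rewrite mul0r addr0.
  rewrite (le_trans _ IH)// -natr1 mulrDl mul1r [X in (_ + X)%R]addrC addrA.
  by rewrite lerD2r decr.
have cpq : (0 < c * (p - q))%R by rewrite mulr_gt0// subr_gt0.
have q0 : (0 <= fine (e 0) / (c * (p - q)))%R by rewrite divr_ge0// ?fine_ge0// ltW.
(* After this many steps the accumulated loss exceeds the initial value [e 0], although every [e j]
   is nonnegative. *)
have := bound (Num.Def.archi_bound (fine (e 0) / (c * (p - q)))%R).
rewrite leNgt => /negP; apply.
rewrite ltr_wpDl ?fine_ge0//.
by rewrite -ltr_pdivrMr// archi_boundP.
Qed.
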